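(* Let $\alpha=1/2$. The curve $\partial_0N_+=\{(a_{x_0}(P(x_0)/2),\,b_{x_0}(P(x_0)/2),0): x_0\in(1/\sqrt3,1)\}$ is, in the Cartesian coordinates of the plane $Z=0$, the graph (of the second coordinate over the first) of a non-increasing function.
   Context: $G_{1/2}$ is the Lie group $\mathbb{R}^3$ with product $(x,y,z)\ast(x',y',z')=(x'e^{z}+x,\;y'e^{-z/2}+y,\;z'+z)$ and left-invariant metric $ds^2=e^{-2z}dx^2+e^{z}dy^2+dz^2$. Its Lie algebra is identified with $\mathbb{R}^3$ via the orthonormal frame $X=e^{z}\partial_x,\ Y=e^{-z/2}\partial_y,\ Z=\partial_z$. $E$ is the Riemannian exponential map at the identity. On the unit sphere of the Lie algebra let $\Sigma(x,y,z)=(xz,-\tfrac12 yz,\tfrac12 y^2-x^2)$. For $x_0\in(1/\sqrt3,1)$ the integral curve of $\Sigma$ through $(x_0,\sqrt{1-x_0^2},0)$ is closed, and $P(x_0)$ denotes its minimal period. Let $(x(t),y(t),z(t))$ solve $x'=-xz,\ y'=\tfrac12 yz,\ z'=x^2-\tfrac12y^2$ with initial value $(x_0,\sqrt{1-x_0^2},0)$, and let $(a_{x_0}(t),b_{x_0}(t),0)=E\big(2t\,(x(t),y(t),z(t))\big)$ for $t\in(0,P(x_0)/2]$. Equivalently, $a'=2x+az,\ b'=2y-\tfrac12bz$, $a(0)=b(0)=0$. *)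

(* Defs.v *)
From Stdlib Require Import Reals Lra ClassicalEpsilon.
From Coquelicot Require Import Coquelicot.

Open Scope R_scope.

Inductive axis := ax_x | ax_y | ax_z.

Definition sum3 (f : axis -> R) : R := f ax_x + f ax_y + f ax_z.

Definition R3 : Type := (R * R * R)%type.

Definition coord (p : R3) (i : axis) : R :=
  let '(x, y, z) := p in
  match i with ax_x => x | ax_y => y | ax_z => z end.

Definition set_coord (p : R3) (i : axis) (s : R) : R3 :=
  let '(x, y, z) := p in
  match i with ax_x => (s, y, z) | ax_y => (x, s, z) | ax_z => (x, y, s) end.

Definition scale (k : R) (v : R3) : R3 :=
  let '(x, y, z) := v in (k * x, k * y, k * z).

Definition is_derive3 (c : R -> R3) (t : R) (v : R3) : Prop :=
  forall i, is_derive (fun s => coord (c s) i) t (coord v i).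

Definition partial (i : axis) (f : R3 -> R) (p : R3) : R :=
  Derive (fun s => f (set_coord p i s)) (coord p i).

Definition gmul (p q : R3) : R3 :=
  let '(x, y, z) := p in
  let '(x', y', z') := q in
  (x' * exp z + x, y' * exp (- z / 2) + y, z' + z).

Definition gone : R3 := (0, 0, 0).

Lemma gmul_gone_l (p : R3) : gmul gone p = p.
Proof.
destruct p as [[x y] z]; unfold gmul, gone.
replace (- 0 / 2) with 0 by field; rewrite exp_0.
f_equal; [f_equal|]; ring.
Qed.

Lemma gmul_gone_r (p : R3) : gmul p gone = p.
Proof.
destruct p as [[x y] z]; unfold gmul, gone.
f_equal; [f_equal|]; ring.
Qed.

(* The coordinate components at p of v_1 X + v_2 Y + v_3 Z, where X, Y, Z is
   the left-invariant orthonormal frame. *)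
Definition frame (p v : R3) : R3 :=
  let '(x, y, z) := p in
  let '(v1, v2, v3) := v in
  (v1 * exp z, v2 * exp (- z / 2), v3).

Definition metric (p : R3) (i j : axis) : R :=
  let '(x, y, z) := p in
  match i, j with
  | ax_x, ax_x => exp (- 2 * z)
  | ax_y, ax_y => exp z
  | ax_z, ax_z => 1
  | _, _ => 0
  end.

Lemma frame_isometry (p v w : R3) :
  sum3 (fun i => sum3 (fun j =>
    metric p i j * coord (frame p v) i * coord (frame p w) j)) =
  sum3 (fun i => coord v i * coord w i).
Proof.
destruct p as [[x y] z], v as [[v1 v2] v3], w as [[w1 w2] w3].
unfold sum3; simpl.
assert (H1 : exp (- 2 * z) * (exp z * exp z) = 1).
{ rewrite <- !exp_plus, <- exp_0; f_equal; ring. }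
assert (H2 : exp z * (exp (- z / 2) * exp (- z / 2)) = 1).
{ rewrite <- !exp_plus, <- exp_0; f_equal; field. }
transitivity (exp (- 2 * z) * (exp z * exp z) * (v1 * w1)
  + exp z * (exp (- z / 2) * exp (- z / 2)) * (v2 * w2) + v3 * w3);
  [|rewrite H1, H2]; ring.
Qed.

(* Christoffel symbols of the first kind of the Levi-Civita connection:
   christoffel p k i j = < nabla_{d_i} d_j , d_k > at p. *)
Definition christoffel (p : R3) (k i j : axis) : R :=
  / 2 * (partial i (fun q => metric q k j) p
         + partial j (fun q => metric q k i) p
         - partial k (fun q => metric q i j) p).

(* The geodesic equation with its free index k lowered by the metric:
   < nabla_{gamma'} gamma' , d_k > = 0.  Geodesics are taken on the whole
   line: a left-invariant metric is complete. *)
Definition is_geodesic (gamma : R -> R3) : Prop :=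
  exists vel acc : R -> R3,
    (forall t, is_derive3 gamma t (vel t)) /\
    (forall t, is_derive3 vel t (acc t)) /\
    (forall t k,
       sum3 (fun j => metric (gamma t) k j * coord (acc t) j)
       + sum3 (fun i => sum3 (fun j =>
           christoffel (gamma t) k i j * coord (vel t) i * coord (vel t) j))
       = 0).

(* Riemannian (not Lie-group) exponential at the identity; its argument is
   given by components in the frame X, Y, Z. *)
Definition riem_exp (v : R3) : R3 :=
  epsilon (inhabits gone) (fun p => exists gamma : R -> R3,
    is_geodesic gamma /\ gamma 0 = gone /\
    is_derive3 gamma 0 (frame gone v) /\ gamma 1 = p).

(* Defined on all of R3, but tangent to the unit sphere. *)
Definition Sigma (v : R3) : R3 :=
  let '(x, y, z) := v in (x * z, - / 2 * (y * z), / 2 * y ^ 2 - x ^ 2).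

Definition is_integral_curve (V : R3 -> R3) (c : R -> R3) : Prop :=
  forall t, is_derive3 c t (V (c t)).

Definition is_period (c : R -> R3) (T : R) : Prop :=
  0 < T /\ forall t, c (t + T) = c t.

Definition is_minimal_period (c : R -> R3) (T : R) : Prop :=
  is_period c T /\ forall T', is_period c T' -> T <= T'.

Definition start (x0 : R) : R3 := (x0, sqrt (1 - x0 ^ 2), 0).

(* [u x0] is the solution x' = -xz, y' = yz/2, z' = x^2 - y^2/2 from
   [start x0]; the point is E(2t u(t)) at t = P(x0)/2. *)
Definition boundary0_Nplus (P : R -> R) (u : R -> R -> R3) (p : R3) : Prop :=
  exists x0, 1 / sqrt 3 < x0 < 1 /\
    p = riem_exp (scale (2 * (P x0 / 2)) (u x0 (P x0 / 2))).

(* S lies in the plane Z = 0 and is there the graph, over its projection D to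
   the first coordinate, of a non-increasing function. *)
Definition is_nonincreasing_graph (S : R3 -> Prop) : Prop :=
  exists (D : R -> Prop) (f : R -> R),
    (forall a a', D a -> D a' -> a <= a' -> f a' <= f a) /\
    (forall a b z, S (a, b, z) <-> D a /\ b = f a /\ z = 0).

(* Main.v *)
Require Import Defs.
From Stdlib Require Import Reals Lra Psatz ClassicalEpsilon.
From Coquelicot Require Import Coquelicot.

Open Scope R_scope.

(* The integral curve of Sigma through (x0, ., 0) satisfies x y^2 = const and
   x^2 + y^2 + z^2 = 1. With x = m (1 + q cos th) as x runs between its extremes
   m (1 + q) = x0 and m (1 - q), the time is dt = dth / sqrt (x (x + 2 m)), so
   half the period is reached at th = pi. The geodesic ending at the boundary
   point has momentum running once around this curve, starting and ending at its
   lowest x. Since the x-momentum is proportional to e^z and the y-momentum to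
   e^(-z/2), the endpoint is
     (K(q) / (1 - q), sqrt 2 K(q) / sqrt (1 + q), 0),
   K(q) = int_{-pi}^{pi} F(q cos th) dth,  F(u) = (1 + u)^(3/2) (3 + u)^(-1/2).
   F is convex, hence so is K, and K'(0) = 0, so the first coordinate strictly
   increases with q. At q = 1 the integrals become elementary: K(1) = 4 and
   K'(1) = 1. By convexity K' <= 1 and K(q) >= 3 + q >= 2 (1 + q), which is
   exactly what makes K(q) / sqrt (1 + q) non-increasing. *)

(** * Uniqueness for the flow of Sigma *)

Lemma is_derive_continuity_pt (f : R -> R) (t l : R) :
  is_derive f t l -> continuity_pt f t.
Proof.
intros H; apply continuity_pt_filterlim, (ex_derive_continuous f); exists l; exact H.
Qed.

Lemma derive_zero_const (f : R -> R) :
  (forall t, is_derive f t 0) -> forall a b, f a = f b.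
Proof.
intros Hf a b.
destruct (Rtotal_order a b) as [H | [-> | H]]; [|reflexivity|symmetry];
  apply eq_is_derive; auto.
Qed.

Definition component (c : R -> R3) (i : axis) (t : R) : R := coord (c t) i.

(** [auto_derive] leaves terms [Derive g t] for the unknown functions; they are replaced through the
    [is_derive] hypotheses. The final [change] puts the equality at type [R], so that [ring],
    [field] and [lra] accept it. *)
Ltac rewrite_Derive :=
  repeat match goal with
  | H : is_derive ?f ?t ?l |- context [Derive ?g ?t] =>
      rewrite (is_derive_unique g t l H)
  end;
  match goal with |- @eq _ ?a ?b => change (@eq R a b) end.

Ltac derive_using_hyps :=
  auto_derive;
  [repeat apply conj; try exact I; eexists; eassumption | rewrite_Derive].

(** The factor [k] is there because the flow also occurs with reversed time and with [th] in place
    of time. *)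
Lemma is_derive3_Sigma (c : R -> R3) (k t : R) :
  is_derive3 c t (scale k (Sigma (c t))) <->
  is_derive (component c ax_x) t (k * (component c ax_x t * component c ax_z t)) /\
  is_derive (component c ax_y) t (k * (- / 2 * (component c ax_y t * component c ax_z t))) /\
  is_derive (component c ax_z) t (k * (/ 2 * component c ax_y t ^ 2 - component c ax_x t ^ 2)).
Proof.
assert (E : forall i, coord (scale k (Sigma (c t))) i = match i with
  | ax_x => k * (component c ax_x t * component c ax_z t)
  | ax_y => k * (- / 2 * (component c ax_y t * component c ax_z t))
  | ax_z => k * (/ 2 * component c ax_y t ^ 2 - component c ax_x t ^ 2) end).
{ unfold component; destruct (c t) as [[x y] z]; intros []; reflexivity. }
unfold is_derive3; split.
- intros H; pose proof (H ax_x) as H1; pose proof (H ax_y) as H2;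
    pose proof (H ax_z) as H3; rewrite E in H1, H2, H3; auto.
- intros (H1 & H2 & H3) []; rewrite E; assumption.
Qed.

Lemma R3_ext (p q : R3) : (forall i, coord p i = coord q i) -> p = q.
Proof.
destruct p as [[x y] z], q as [[x' y'] z']; intros H.
pose proof (H ax_x); pose proof (H ax_y); pose proof (H ax_z); simpl in *.
congruence.
Qed.

Lemma is_derive3_comp (c : R -> R3) (f : R -> R) (t k : R) (v : R3) :
  is_derive3 c (f t) v -> is_derive f t k ->
  is_derive3 (fun s => c (f s)) t (scale k v).
Proof.
intros Hc Hf i.
evar_last.
- apply (is_derive_comp (fun s => coord (c s) i) f); [apply Hc | apply Hf].
- destruct v as [[x y] z], i; reflexivity.
Qed.

Lemma scale_scale (k l : R) (v : R3) : scale k (scale l v) = scale (k * l) v.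
Proof.
destruct v as [[x y] z]; simpl; f_equal; [f_equal|]; ring.
Qed.

Lemma scale_1 (v : R3) : scale 1 v = v.
Proof.
destruct v as [[x y] z]; simpl; f_equal; [f_equal|]; ring.
Qed.

(** [Sigma] is tangent to every sphere about 0: [x (x z) - y (y z) / 2 + z (y^2 / 2 - x^2) = 0].
    This gives the global bound that a merely locally Lipschitz field needs for a Gronwall
    argument. *)
Lemma Sigma_norm_conserved (c : R -> R3) (h : R -> R) :
  (forall t, is_derive3 c t (scale (h t) (Sigma (c t)))) ->
  forall s t, sum3 (fun i => coord (c s) i ^ 2) = sum3 (fun i => coord (c t) i ^ 2).
Proof.
intros Hc; apply (derive_zero_const (fun t => sum3 (fun i => coord (c t) i ^ 2))).
intros t; destruct (proj1 (is_derive3_Sigma _ _ _) (Hc t)) as (Hx & Hy & Hz).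
apply (is_derive_ext (fun s => component c ax_x s ^ 2 + component c ax_y s ^ 2 + component c ax_z s ^ 2));
  [intros s; reflexivity|].
derive_using_hyps; lra.
Qed.

(** [D s * exp (- L * s)] vanishes at 0 and has a non-positive derivative, so the mean value theorem
    makes it non-positive. *)
Lemma gronwall_zero (D : R -> R) (D' : R -> R) (L : R) :
  (forall t, is_derive D t (D' t)) -> (forall t, 0 <= D t) ->
  (forall t, D' t <= L * D t) -> D 0 = 0 -> forall t, 0 <= t -> D t = 0.
Proof.
intros HD Hpos Hle H0 t Ht.
destruct (Req_dec t 0) as [-> | Hn]; [assumption|].
assert (HE : forall s, is_derive (fun s => D s * exp (- L * s)) s
  ((D' s - L * D s) * exp (- L * s))).
{ intros s; pose proof (HD s); derive_using_hyps; ring. }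
destruct (MVT_gen (fun s => D s * exp (- L * s)) 0 t
  (fun s => (D' s - L * D s) * exp (- L * s))) as (c & _ & Hc).
- intros s _; apply HE.
- intros s _; exact (is_derive_continuity_pt _ _ _ (HE s)).
- rewrite H0 in Hc.
  cbv beta in Hc; pose proof (Hpos t); pose proof (Hle c).
  pose proof (exp_pos (- L * t)); pose proof (exp_pos (- L * c)).
  assert (0 <= (L * D c - D' c) * exp (- L * c) * t)
    by (apply Rmult_le_pos; [apply Rmult_le_pos|]; lra).
  assert (D t * exp (- L * t) <= 0) by lra.
  nra.
Qed.

Lemma Sigma_unique_forward (f g : R -> R3) (h : R -> R) (B : R) :
  (forall t, Rabs (h t) <= B) ->
  (forall t, is_derive3 f t (scale (h t) (Sigma (f t)))) ->
  (forall t, is_derive3 g t (scale (h t) (Sigma (g t)))) ->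
  f 0 = g 0 -> forall t, 0 <= t -> f t = g t.
Proof.
intros HB Hf Hg H0 t Ht.
set (N := sum3 (fun i => coord (f 0) i ^ 2)).
assert (HN : forall s, sum3 (fun i => coord (f s) i ^ 2) = N)
  by (intros s; apply (Sigma_norm_conserved f h Hf)).
(* A coordinate whose square is at most [N] is at most [N + 1] in absolute value, which avoids a
   square root. *)
assert (Hb : forall s i, Rabs (h s * coord (f s) i) <= B * (N + 1)).
{ intros s i; rewrite Rabs_mult.
  apply Rmult_le_compat; try apply Rabs_pos; [apply HB|].
  specialize (HN s); unfold sum3 in HN.
  apply Rabs_le.
  pose proof (pow2_ge_0 (coord (f s) ax_x)); pose proof (pow2_ge_0 (coord (f s) ax_y));
  pose proof (pow2_ge_0 (coord (f s) ax_z)).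
  assert (coord (f s) i ^ 2 <= N) by (destruct i; lra).
  split; nra. }
clearbody N.
assert (HD : sum3 (fun i => (coord (f t) i - coord (g t) i) ^ 2) = 0).
(* Put [d = f - g]. As [Sigma] is quadratic and [Sigma d] is orthogonal to [d], the terms cubic in
   [d] cancel: the derivative of [|d|^2] is a quadratic form in [d] with coefficients linear in [f]
   alone. *)
{ apply (gronwall_zero (fun t => sum3 (fun i => (coord (f t) i - coord (g t) i) ^ 2))
    (fun t => h t * (2 * coord (f t) ax_z * (coord (f t) ax_x - coord (g t) ax_x) ^ 2
      - coord (f t) ax_z * (coord (f t) ax_y - coord (g t) ax_y) ^ 2
      - 2 * coord (f t) ax_x * (coord (f t) ax_x - coord (g t) ax_x)
          * (coord (f t) ax_z - coord (g t) ax_z)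
      + coord (f t) ax_y * (coord (f t) ax_y - coord (g t) ax_y)
          * (coord (f t) ax_z - coord (g t) ax_z))) (4 * (B * (N + 1)))); auto.
  - clear t Ht; intros t.
    destruct (proj1 (is_derive3_Sigma _ _ _) (Hf t)) as (Hx & Hy & Hz).
    destruct (proj1 (is_derive3_Sigma _ _ _) (Hg t)) as (Hx' & Hy' & Hz').
    apply (is_derive_ext (fun s => (component f ax_x s - component g ax_x s) ^ 2 +
      (component f ax_y s - component g ax_y s) ^ 2 + (component f ax_z s - component g ax_z s) ^ 2));
      [intros s; reflexivity|].
    derive_using_hyps; unfold component; lra.
  - intros s; unfold sum3; repeat apply Rplus_le_le_0_compat; apply pow2_ge_0.
  - intros s.
    pose proof (Hb s ax_x) as H1; pose proof (Hb s ax_y) as H2; pose proof (Hb s ax_z) as H3.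
    apply Rabs_le_between in H1; apply Rabs_le_between in H2; apply Rabs_le_between in H3.
    unfold sum3.
    set (A := B * (N + 1)) in *; clearbody A.
    set (dx := coord (f s) ax_x - _); set (dy := coord (f s) ax_y - _);
      set (dz := coord (f s) ax_z - _); clearbody dx dy dz.
    set (p := h s * coord (f s) ax_x) in *; set (q := h s * coord (f s) ax_y) in *;
      set (r := h s * coord (f s) ax_z) in *.
    apply Rle_trans with
      (2 * r * dx ^ 2 - r * dy ^ 2 - 2 * p * dx * dz + q * dy * dz).
    + apply Req_le; unfold p, q, r; ring.
    + clearbody p q r.
      (* The mixed terms are absorbed by squares, [- 2 p dx dz <= A (dx^2 + dz^2)] and
         [q dy dz <= A (dy^2 + dz^2) / 2]; the total stays below [4 A |d|^2]. *)
      pose proof (Rmult_le_pos (A - r) (dx ^ 2) ltac:(lra) (pow2_ge_0 _)).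
      pose proof (Rmult_le_pos (A + r) (dy ^ 2) ltac:(lra) (pow2_ge_0 _)).
      pose proof (Rmult_le_pos (A - p) ((dx - dz) ^ 2) ltac:(lra) (pow2_ge_0 _)).
      pose proof (Rmult_le_pos (A + p) ((dx + dz) ^ 2) ltac:(lra) (pow2_ge_0 _)).
      pose proof (Rmult_le_pos (A - q) ((dy + dz) ^ 2) ltac:(lra) (pow2_ge_0 _)).
      pose proof (Rmult_le_pos (A + q) ((dy - dz) ^ 2) ltac:(lra) (pow2_ge_0 _)).
      pose proof (Rmult_le_pos A (dx ^ 2) ltac:(lra) (pow2_ge_0 _)).
      pose proof (Rmult_le_pos A (dy ^ 2) ltac:(lra) (pow2_ge_0 _)).
      pose proof (Rmult_le_pos A (dz ^ 2) ltac:(lra) (pow2_ge_0 _)).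
      nra.
  - unfold sum3; rewrite H0; ring. }
unfold sum3 in HD.
apply R3_ext; intros i.
pose proof (pow2_ge_0 (coord (f t) ax_x - coord (g t) ax_x)).
pose proof (pow2_ge_0 (coord (f t) ax_y - coord (g t) ax_y)).
pose proof (pow2_ge_0 (coord (f t) ax_z - coord (g t) ax_z)).
assert ((coord (f t) i - coord (g t) i) ^ 2 = 0) by (destruct i; lra).
nra.
Qed.

Lemma Sigma_unique (f g : R -> R3) (h : R -> R) (B : R) :
  (forall t, Rabs (h t) <= B) ->
  (forall t, is_derive3 f t (scale (h t) (Sigma (f t)))) ->
  (forall t, is_derive3 g t (scale (h t) (Sigma (g t)))) ->
  f 0 = g 0 -> forall t, f t = g t.
Proof.
intros HB Hf Hg H0 t.
destruct (Rle_dec 0 t) as [Ht | Ht].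
- apply (Sigma_unique_forward f g h B); auto.
- replace t with (- - t) by ring.
  (* Negative times reduce to positive ones: reversing time only replaces [h t] by [- h (- t)]. *)
  assert (R' : forall c : R -> R3, (forall t, is_derive3 c t (scale (h t) (Sigma (c t)))) ->
    forall t, is_derive3 (fun s => c (- s)) t (scale (- h (- t)) (Sigma (c (- t))))).
  { intros c Hc s.
    replace (scale (- h (- s)) (Sigma (c (- s))))
      with (scale (-1) (scale (h (- s)) (Sigma (c (- s)))))
      by (rewrite scale_scale; f_equal; ring).
    apply (is_derive3_comp c Ropp); [apply Hc|].
    auto_derive; auto; ring. }
  apply (Sigma_unique_forward (fun s => f (- s)) (fun s => g (- s)) (fun s => - h (- s)) B).
  + intros s; rewrite Rabs_Ropp; apply HB.
  + exact (R' f Hf).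
  + exact (R' g Hg).
  + rewrite Ropp_0; assumption.
  + lra.
Qed.

Lemma integral_curve_unique (c d : R -> R3) :
  is_integral_curve Sigma c -> is_integral_curve Sigma d -> c 0 = d 0 ->
  forall t, c t = d t.
Proof.
intros Hc Hd; apply (Sigma_unique c d (fun _ => 1) 1); intros t;
  [rewrite Rabs_R1; lra | rewrite scale_1; auto..].
Qed.

(** * Geodesics and their momentum *)

Lemma antiderivative_exists (f : R -> R) : (forall t, continuous f t) ->
  exists g : R -> R, g 0 = 0 /\ forall t, is_derive g t (f t).
Proof.
intros Hf; exists (RInt f 0); split; [exact (RInt_point (V := R_CompleteNormedModule) 0 f)|intros t].
apply (is_derive_RInt f (RInt f 0) 0 t); [|apply Hf].
apply filter_forall; intros s; apply (RInt_correct (V := R_CompleteNormedModule)).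
apply (ex_RInt_continuous (V := R_CompleteNormedModule)); auto.
Qed.

Lemma partial_metric (i j k : axis) (p : R3) :
  partial i (fun q => metric q j k) p =
  match i, j, k with
  | ax_z, ax_x, ax_x => - 2 * exp (- 2 * coord p ax_z)
  | ax_z, ax_y, ax_y => exp (coord p ax_z)
  | _, _, _ => 0
  end.
Proof.
destruct p as [[x y] z]; unfold partial.
destruct i, j, k; simpl; try apply Derive_const;
  apply is_derive_unique; auto_derive; auto; ring.
Qed.

(** The witness is the velocity read in the left-invariant frame, that is [frame] inverted. In these
    components the geodesic equation becomes the autonomous Euler equation on the Lie algebra. *)
Lemma geodesic_momentum (gamma : R -> R3) : is_geodesic gamma ->
  exists w, is_integral_curve Sigma w /\
    forall t, is_derive3 gamma t (frame (gamma t) (w t)).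
Proof.
intros (vel & acc & Hg & Hv & Hgeo).
exists (fun t => (component vel ax_x t * exp (- component gamma ax_z t),
  component vel ax_y t * exp (component gamma ax_z t / 2), component vel ax_z t)).
split; intros t.
- pose proof (Hg t ax_z : is_derive (component gamma ax_z) t (component vel ax_z t)) as Hz.
  pose proof (Hv t ax_x : is_derive (component vel ax_x) t (component acc ax_x t)) as Hvx.
  pose proof (Hv t ax_y : is_derive (component vel ax_y) t (component acc ax_y t)) as Hvy.
  pose proof (Hv t ax_z : is_derive (component vel ax_z) t (component acc ax_z t)) as Hvz.
  pose proof (Hgeo t ax_x) as Gx; pose proof (Hgeo t ax_y) as Gy; pose proof (Hgeo t ax_z) as Gz.
  unfold sum3, christoffel in Gx, Gy, Gz; rewrite !partial_metric in Gx, Gy, Gz.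
  fold (component vel ax_x t) (component vel ax_y t) (component vel ax_z t) in Gx, Gy, Gz.
  fold (component acc ax_x t) (component acc ax_y t) (component acc ax_z t) in Gx, Gy, Gz.
  fold (component gamma ax_z t) in Gx, Gy, Gz.
  assert (E : forall i j, metric (gamma t) i j = match i, j with
    | ax_x, ax_x => exp (- 2 * component gamma ax_z t)
    | ax_y, ax_y => exp (component gamma ax_z t)
    | ax_z, ax_z => 1
    | _, _ => 0 end) by (unfold component; destruct (gamma t) as [[x y] z]; reflexivity).
  rewrite !E in Gx, Gy, Gz; clear E Hg Hv Hgeo.
  (* All exponentials involved are integer powers of this one positive number, so the remaining
     identities are rational. *)
  set (e := exp (component gamma ax_z t / 2)).
  assert (He : 0 < e) by apply exp_pos.
  assert (E1 : exp (component gamma ax_z t) = e ^ 2)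
    by (unfold e; simpl; rewrite Rmult_1_r, <- exp_plus; f_equal; field).
  assert (E2 : exp (- component gamma ax_z t) = / e ^ 2) by (rewrite exp_Ropp, E1; reflexivity).
  assert (E3 : exp (- 2 * component gamma ax_z t) = / e ^ 4).
  { replace (- 2 * component gamma ax_z t) with (- component gamma ax_z t + - component gamma ax_z t) by ring.
    rewrite exp_plus, E2; field; lra. }
  rewrite E3 in Gx, Gz; rewrite E1 in Gy, Gz.
  assert (Gx' : component acc ax_x t = 2 * component vel ax_x t * component vel ax_z t).
  { apply (Rmult_eq_reg_l (/ e ^ 4)); [|apply Rinv_neq_0_compat, pow_nonzero; lra]; lra. }
  assert (Gy' : component acc ax_y t = - component vel ax_y t * component vel ax_z t).
  { apply (Rmult_eq_reg_l (e ^ 2)); [|apply pow_nonzero; lra]; lra. }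
  intros [].
  + change (is_derive (fun s => component vel ax_x s * exp (- component gamma ax_z s)) t
      (component vel ax_x t * exp (- component gamma ax_z t) * component vel ax_z t)).
    derive_using_hyps; rewrite Gx'; ring.
  + change (is_derive (fun s => component vel ax_y s * exp (component gamma ax_z s / 2)) t
      (- / 2 * (component vel ax_y t * exp (component gamma ax_z t / 2) * component vel ax_z t))).
    derive_using_hyps; fold (component gamma ax_z t / 2); rewrite Gy'; lra.
  + change (is_derive (component vel ax_z) t
      (/ 2 * (component vel ax_y t * exp (component gamma ax_z t / 2)) ^ 2
       - (component vel ax_x t * exp (- component gamma ax_z t)) ^ 2)).
    evar_last; [exact Hvz|].
    rewrite E2; fold e.
    match goal with |- @eq _ ?a ?b => change (@eq R a b) end.
    apply Rminus_diag_uniq; rewrite <- Gz; field; lra.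
- intros i; pose proof (Hg t i) as H.
  replace (coord (frame (gamma t) _) i) with (coord (vel t) i); [exact H|].
  unfold component; destruct (gamma t) as [[x y] z], (vel t) as [[a b] c], i; simpl.
  + rewrite Rmult_assoc, <- exp_plus, Rplus_opp_l, exp_0; ring.
  + rewrite Rmult_assoc, <- exp_plus; replace (z / 2 + - z / 2) with 0 by field.
    rewrite exp_0; ring.
  + reflexivity.
Qed.

(** The frame depends on [z] only, so the curve is found by successive integrations: first
    [z' = w_z], then [x' = w_x e^z] and [y' = w_y e^(-z/2)]. *)
Lemma geodesic_of_momentum (w : R -> R3) : is_integral_curve Sigma w ->
  exists gamma, is_geodesic gamma /\ gamma 0 = gone /\
    forall t, is_derive3 gamma t (frame (gamma t) (w t)).
Proof.
intros Hw.
assert (Hw' : forall t, is_derive3 w t (scale 1 (Sigma (w t))))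
  by (intros t; rewrite scale_1; apply Hw).
assert (Cw : forall i t, continuous (component w i) t)
  by (intros i t; apply (ex_derive_continuous (component w i)); eexists; apply Hw).
destruct (antiderivative_exists (component w ax_z) (Cw ax_z)) as (gz & gz0 & Hz).
assert (Cz : forall (k t : R), continuous (fun s => exp (k * gz s)) t).
{ intros k t; pose proof (Hz t).
  apply (ex_derive_continuous (fun s => exp (k * gz s))); auto_derive.
  eexists; eassumption. }
destruct (antiderivative_exists (fun s => component w ax_x s * exp (1 * gz s))) as (gx & gx0 & Hx).
{ intros t; apply (continuous_mult (component w ax_x)); [apply Cw | apply Cz]. }
destruct (antiderivative_exists (fun s => component w ax_y s * exp (- / 2 * gz s))) as (gy & gy0 & Hy).
{ intros t; apply (continuous_mult (component w ax_y)); [apply Cw | apply Cz]. }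
assert (Ew : forall t, w t = (component w ax_x t, component w ax_y t, component w ax_z t))
  by (intros t; apply R3_ext; intros []; reflexivity).
assert (Hg : forall t, is_derive3 (fun t => (gx t, gy t, gz t)) t
  (frame (gx t, gy t, gz t) (w t))).
{ intros t; rewrite Ew; intros []; simpl.
  - rewrite <- (Rmult_1_l (gz t)); apply Hx.
  - replace (- gz t / 2) with (- / 2 * gz t) by field; apply Hy.
  - apply Hz. }
exists (fun t => (gx t, gy t, gz t)); split; [|split; [|exact Hg]].
2: unfold gone; congruence.
exists (fun t => frame (gx t, gy t, gz t) (w t)),
  (fun t => (2 * component w ax_x t * exp (gz t) * component w ax_z t,
    - (component w ax_y t * exp (- gz t / 2)) * component w ax_z t,
    / 2 * component w ax_y t ^ 2 - component w ax_x t ^ 2)).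
split; [exact Hg|split].
- intros t; destruct (proj1 (is_derive3_Sigma _ _ _) (Hw' t)) as (Wx & Wy & Wz).
  pose proof (Hz t).
  intros [].
  + apply (is_derive_ext (fun s => component w ax_x s * exp (gz s)));
      [intros s; rewrite Ew; reflexivity|]; simpl.
    derive_using_hyps; ring.
  + apply (is_derive_ext (fun s => component w ax_y s * exp (- gz s / 2)));
      [intros s; rewrite Ew; reflexivity|]; simpl.
    derive_using_hyps; fold (- gz t / 2); lra.
  + apply (is_derive_ext (component w ax_z));
      [intros s; rewrite Ew; reflexivity|]; simpl.
    evar_last; [exact Wz|]; simpl; lra.
- intros t k; rewrite Ew; unfold sum3, christoffel; rewrite !partial_metric.
  set (e := exp (- gz t / 2)).
  assert (He : 0 < e) by apply exp_pos.
  assert (E1 : exp (gz t) = / e ^ 2).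
  { rewrite <- (Ropp_involutive (gz t)), exp_Ropp; f_equal.
    unfold e; simpl; rewrite Rmult_1_r, <- exp_plus; f_equal; field. }
  assert (E3 : exp (- 2 * gz t) = e ^ 4).
  { unfold e; simpl; rewrite Rmult_1_r, <- !exp_plus; f_equal; field. }
  destruct k; simpl; fold e; rewrite ?E1, ?E3; field; lra.
Qed.

Lemma frame_gone (v : R3) : frame gone v = v.
Proof.
destruct v as [[x y] z]; unfold frame, gone.
replace (- 0 / 2) with 0 by field; rewrite exp_0, !Rmult_1_r; reflexivity.
Qed.

Lemma is_derive3_unique (c : R -> R3) (t : R) (v w : R3) :
  is_derive3 c t v -> is_derive3 c t w -> v = w.
Proof.
intros Hv Hw; apply R3_ext; intros i.
rewrite <- (is_derive_unique _ _ _ (Hv i)); apply is_derive_unique, Hw.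
Qed.

(** [geodesic_of_momentum] shows that the choice in [riem_exp] is made from a non-empty set.
    Whichever geodesic realises it, its momentum starts at [w 0], because the frame at the identity
    is trivial, and so equals [w] by uniqueness. *)
Lemma riem_exp_momentum (w : R -> R3) : is_integral_curve Sigma w ->
  exists gamma, gamma 0 = gone /\
    (forall t, is_derive3 gamma t (frame (gamma t) (w t))) /\
    riem_exp (w 0) = gamma 1.
Proof.
intros Hw.
destruct (geodesic_of_momentum w Hw) as (g0 & Hgeo & H0 & Hd).
destruct (epsilon_spec (inhabits gone) (fun p => exists gamma : R -> R3,
  is_geodesic gamma /\ gamma 0 = gone /\
  is_derive3 gamma 0 (frame gone (w 0)) /\ gamma 1 = p)) as (g & Hg & Hg0 & Hgd & Hg1).
{ exists (g0 1), g0; repeat split; auto; rewrite <- H0; apply Hd. }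
destruct (geodesic_momentum g Hg) as (w' & Hw' & Hd').
assert (Ew : forall t, w' t = w t).
{ apply integral_curve_unique; [assumption..|].
  rewrite <- (frame_gone (w' 0)), <- (frame_gone (w 0)).
  apply (is_derive3_unique g 0); [rewrite <- Hg0; apply Hd' | assumption]. }
exists g; split; [assumption|split; [|symmetry; exact Hg1]].
intros t; rewrite <- Ew; apply Hd'.
Qed.

(* Along a geodesic the momentum is [w_x = w_x(0) e^z], [w_y = w_y(0) e^(-z/2)]:
   these come from the Killing fields [d_x] and [d_y]. *)
Lemma geodesic_loop (w gamma : R -> R3) (p q : R) :
  is_integral_curve Sigma w -> gamma 0 = gone ->
  (forall t, is_derive3 gamma t (frame (gamma t) (w t))) ->
  0 < p -> 0 < q -> w 0 = (p, q, 0) -> w 1 = (p, q, 0) ->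
  (forall t, is_derive (component gamma ax_x) t (component w ax_x t ^ 2 / p)) /\
  q * component gamma ax_y 1 = 2 * p * component gamma ax_x 1 /\ component gamma ax_z 1 = 0.
Proof.
intros Hw H0 Hg Hp Hq W0 W1.
assert (Hw' : forall t, is_derive3 w t (scale 1 (Sigma (w t))))
  by (intros t; rewrite scale_1; apply Hw).
assert (Hd : forall t,
  is_derive (component gamma ax_x) t (component w ax_x t * exp (component gamma ax_z t)) /\
  is_derive (component gamma ax_y) t (component w ax_y t * exp (- component gamma ax_z t / 2)) /\
  is_derive (component gamma ax_z) t (component w ax_z t)).
{ intros t.
  assert (E : forall i, coord (frame (gamma t) (w t)) i = match i with
    | ax_x => component w ax_x t * exp (component gamma ax_z t)
    | ax_y => component w ax_y t * exp (- component gamma ax_z t / 2)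
    | ax_z => component w ax_z t end)
    by (unfold component; destruct (gamma t) as [[? ?] ?], (w t) as [[? ?] ?]; intros []; reflexivity).
  pose proof (Hg t ax_x) as X; pose proof (Hg t ax_y) as Y; pose proof (Hg t ax_z) as Z.
  rewrite E in X, Y, Z; auto. }
assert (Gz0 : component gamma ax_z 0 = 0) by (unfold component; rewrite H0; reflexivity).
assert (Ex : forall t, component w ax_x t = p * exp (component gamma ax_z t)).
{ intros t.
  assert (E : component w ax_x t * exp (- component gamma ax_z t) = p).
  { rewrite (derive_zero_const (fun t => component w ax_x t * exp (- component gamma ax_z t)))
      with (b := 0).
    - rewrite Gz0, Ropp_0, exp_0; unfold component; rewrite W0; simpl; ring.
    - intros s; destruct (proj1 (is_derive3_Sigma _ _ _) (Hw' s)) as (X & _ & _).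
      destruct (Hd s) as (_ & _ & Z); derive_using_hyps; ring. }
  rewrite <- E, Rmult_assoc, <- exp_plus, Rplus_opp_l, exp_0; ring. }
assert (Ey : forall t, component w ax_y t = q * exp (- component gamma ax_z t / 2)).
{ intros t.
  assert (E : component w ax_y t * exp (component gamma ax_z t / 2) = q).
  { rewrite (derive_zero_const (fun t => component w ax_y t * exp (component gamma ax_z t / 2)))
      with (b := 0).
    - rewrite Gz0; replace (0 / 2) with 0 by field.
      rewrite exp_0; unfold component; rewrite W0; simpl; ring.
    - intros s; destruct (proj1 (is_derive3_Sigma _ _ _) (Hw' s)) as (_ & Y & _).
      destruct (Hd s) as (_ & _ & Z); derive_using_hyps; lra. }
  rewrite <- E, Rmult_assoc, <- exp_plus.
  replace (component gamma ax_z t / 2 + - component gamma ax_z t / 2) with 0 by field.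
  rewrite exp_0; ring. }
assert (Dx : forall t, is_derive (component gamma ax_x) t (component w ax_x t ^ 2 / p)).
{ intros t; destruct (Hd t) as (X & _ & _).
  replace (component w ax_x t ^ 2 / p) with (component w ax_x t * exp (component gamma ax_z t));
    [exact X | rewrite Ex; field; lra]. }
assert (Dy : forall t, is_derive (component gamma ax_y) t (component w ax_y t ^ 2 / q)).
{ intros t; destruct (Hd t) as (_ & Y & _).
  replace (component w ax_y t ^ 2 / q)
    with (component w ax_y t * exp (- component gamma ax_z t / 2));
    [exact Y | rewrite Ey; field; lra]. }
split; [exact Dx|split].
(* Since [w_z' = w_y^2 / 2 - w_x^2], the formulas [Dx] and [Dy] make this quantity constant; [w_z]
   vanishes at both ends, which ties the two endpoint coordinates together. *)
- assert (E : q / 2 * component gamma ax_y 1 - p * component gamma ax_x 1 - component w ax_z 1 =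
    q / 2 * component gamma ax_y 0 - p * component gamma ax_x 0 - component w ax_z 0).
  { apply (derive_zero_const
      (fun t => q / 2 * component gamma ax_y t - p * component gamma ax_x t - component w ax_z t)).
    intros s; destruct (proj1 (is_derive3_Sigma _ _ _) (Hw' s)) as (_ & _ & Z).
    pose proof (Dx s); pose proof (Dy s); clear Hd.
    derive_using_hyps; field; lra. }
  unfold component at 3 4 5 6 in E; rewrite H0, W0, W1 in E; simpl in E; lra.
- assert (E : p * exp (component gamma ax_z 1) = p * exp 0).
  { rewrite <- Ex, exp_0; unfold component; rewrite W1; simpl; ring. }
  apply exp_inv, (Rmult_eq_reg_l p); lra.
Qed.

(** * The integral K *)

(* On the level curve of parameters [m, q] below, [x^2 dt = m F(q cos th) dth]. *)
Definition F (u : R) : R := (1 + u) * sqrt ((1 + u) / (3 + u)).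
Definition dF (u : R) : R := (4 + u) / (3 + u) * sqrt ((1 + u) / (3 + u)).

Lemma is_derive_F (u : R) : -1 < u -> is_derive F u (dF u).
Proof.
intros Hu; unfold F, dF.
assert (Hs : 0 < (1 + u) / (3 + u)) by (apply Rdiv_lt_0_compat; lra).
pose proof (sqrt_lt_R0 _ Hs) as Hr.
auto_derive; [repeat split; auto; lra|].
fold ((1 + u) / (3 + u)).
pose proof (sqrt_sqrt _ (Rlt_le _ _ Hs)) as E.
set (r := sqrt ((1 + u) / (3 + u))) in *; clearbody r.
assert (E' : 1 + u = r * r * (3 + u)) by (rewrite E; field; lra).
assert (Hu3 : 3 + u <> 0) by lra.
apply Rminus_diag_uniq.
transitivity ((1 + u - r * r * (3 + u)) / (r * (3 + u) ^ 2)); [field; lra|].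
rewrite <- E'; field; lra.
Qed.

(** The endpoint [u = -1] is reached when [q = 1] and [cos th = -1]. Continuity there is two-sided
    because [sqrt] is 0 on negative numbers. *)
Lemma continuous_ratio_sqrt (u : R) :
  -1 <= u -> continuous (fun u => sqrt ((1 + u) / (3 + u))) u.
Proof.
intros Hu; apply continuous_comp; [|apply continuous_sqrt].
apply (ex_derive_continuous (fun u => (1 + u) / (3 + u))); auto_derive; lra.
Qed.

Lemma continuous_F (u : R) : -1 <= u -> continuous F u.
Proof.
intros Hu; apply (continuous_mult (fun u => 1 + u)); [|apply continuous_ratio_sqrt, Hu].
apply (ex_derive_continuous (fun u => 1 + u)); auto_derive; auto.
Qed.

Lemma continuous_dF (u : R) : -1 <= u -> continuous dF u.
Proof.
intros Hu; apply (continuous_mult (fun u => (4 + u) / (3 + u)));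
  [|apply continuous_ratio_sqrt, Hu].
apply (ex_derive_continuous (fun u => (4 + u) / (3 + u))); auto_derive; lra.
Qed.

(* With [t = 3 + u], [dF u] is the square root of [1 - 3 / t^2 - 2 / t^3]. *)
Lemma dF_le (u v : R) : -1 <= u -> u <= v -> dF u <= dF v.
Proof.
intros Hu Huv.
assert (E : forall w, -1 <= w -> dF w = sqrt (1 - 3 * (/ (3 + w)) ^ 2 - 2 * (/ (3 + w)) ^ 3)).
{ intros w Hw; unfold dF.
  rewrite <- (sqrt_pow2 ((4 + w) / (3 + w))) at 1 by (apply Rdiv_le_0_compat; lra).
  rewrite <- sqrt_mult; [f_equal; field; lra | apply pow2_ge_0 | apply Rdiv_le_0_compat; lra]. }
rewrite !E by lra; apply sqrt_le_1_alt.
assert (H : / (3 + v) <= / (3 + u)) by (apply Rinv_le_contravar; lra).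
assert (H0 : 0 <= / (3 + v)) by (left; apply Rinv_0_lt_compat; lra).
pose proof (pow_incr _ _ 2 (conj H0 H)); pose proof (pow_incr _ _ 3 (conj H0 H)); lra.
Qed.

(* Convexity of [F]. Both bounds are linear in [q - p] with coefficients whose
   integrals over [th], for [C = cos th], are elementary: 0 and 1. *)
Lemma F_increment (p q C : R) : 0 <= p -> p < q -> q <= 1 -> -1 <= C <= 1 ->
  (q - p) * (C * dF 0) <= F (q * C) - F (p * C) <= (q - p) * (C * dF C).
Proof.
intros Hp Hpq Hq HC.
destruct (MVT_gen (fun s => F (s * C)) p q (fun s => C * dF (s * C))) as (s & Hs & E).
- rewrite Rmin_left, Rmax_right by lra; intros s Hs.
  assert (-1 < s * C) by nra.
  apply (is_derive_comp F (fun s => s * C)); [apply is_derive_F; assumption|].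
  auto_derive; auto; ring.
- rewrite Rmin_left, Rmax_right by lra; intros s Hs.
  apply continuity_pt_filterlim, (continuous_comp (fun s => s * C) F);
    [|apply continuous_F; nra].
  apply (ex_derive_continuous (fun s => s * C)); auto_derive; auto.
- rewrite Rmin_left, Rmax_right in Hs by lra.
  cbv beta in E; rewrite E.
  assert (-1 <= s * C) by nra.
  assert (C * dF 0 <= C * dF (s * C) <= C * dF C); [|nra].
  (* [s * C] lies between 0 and [C]. If [C] is negative, the order of the values of [dF] is
     reversed, and multiplying by [C] reverses it back. *)
  destruct (Rle_dec 0 C) as [H0 | H0].
  + split; apply Rmult_le_compat_l; try assumption; apply dF_le; nra.
  + split; apply Rmult_le_compat_neg_l; try lra; apply dF_le; nra.
Qed.

Lemma ex_RInt_F_cos (q : R) : 0 <= q <= 1 -> ex_RInt (fun th => F (q * cos th)) (- PI) PI.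
Proof.
intros Hq; apply (ex_RInt_continuous (V := R_CompleteNormedModule)); intros th _.
pose proof (COS_bound th).
apply (continuous_comp (fun th => q * cos th) F); [|apply continuous_F; nra].
apply (ex_derive_continuous (fun th => q * cos th)); auto_derive; auto.
Qed.

Definition K (q : R) : R := RInt (fun th => F (q * cos th)) (- PI) PI.

(** * Elementary integrals at q = 1 and bounds on K *)

Lemma cos_half (th : R) : cos th = 2 * cos (th / 2) ^ 2 - 1.
Proof.
replace th with (2 * (th / 2)) at 1 by field; rewrite cos_2a_cos; ring.
Qed.

Lemma cos_half_nonneg (th : R) : - PI <= th <= PI -> 0 <= cos (th / 2).
Proof.
intros H; apply cos_ge_0; lra.
Qed.

(** By half angles [1 + cos th = 2 c^2] and [3 + cos th = 2 (2 - s^2)]; on this interval [c >= 0],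
    so the root of [c^2] is [c] itself. *)
Lemma ratio_sqrt_cos (th : R) : - PI <= th <= PI ->
  sqrt ((1 + cos th) / (3 + cos th)) = cos (th / 2) / sqrt (2 - sin (th / 2) ^ 2).
Proof.
intros Hth.
pose proof (cos_half_nonneg _ Hth) as Hc; pose proof (sin2_cos2 (th / 2)) as E.
unfold Rsqr in E.
rewrite cos_half.
set (c := cos (th / 2)) in *; set (s := sin (th / 2)) in *; clearbody c s.
rewrite <- (sqrt_pow2 c Hc) at 3.
rewrite <- sqrt_div_alt by nra.
f_equal; replace (2 - s ^ 2) with (1 + c ^ 2) by lra.
field; split; nra.
Qed.

(** In [s = sin (th / 2)] the integrand becomes [4 (1 - s^2) / sqrt (2 - s^2) ds], with primitive
    [2 s sqrt (2 - s^2)]. *)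
Lemma is_RInt_F_cos : is_RInt (fun th => F (cos th)) (- PI) PI 4.
Proof.
pose proof PI_RGT_0.
evar_last.
- apply (is_RInt_derive (fun th => 2 * (sin (th / 2) * sqrt (2 - sin (th / 2) ^ 2)))
    (fun th => F (cos th)));
    rewrite Rmin_left, Rmax_right by lra; intros th Hth.
  + unfold F; rewrite ratio_sqrt_cos by assumption.
    pose proof (sin2_cos2 (th / 2)) as E; unfold Rsqr in E.
    assert (H2 : 0 < 2 - sin (th / 2) ^ 2) by nra.
    pose proof (sqrt_lt_R0 _ H2); pose proof (sqrt_sqrt _ (Rlt_le _ _ H2)) as Es.
    auto_derive;
      replace (2 + - (sin (th * / 2) * (sin (th * / 2) * 1)))
        with (2 - sin (th / 2) ^ 2) by (unfold Rdiv; ring);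
      [repeat apply conj; auto; lra|].
    rewrite (cos_half th).
    fold (th / 2).
    set (c := cos (th / 2)) in *; set (s := sin (th / 2)) in *.
    set (r := sqrt (2 - s ^ 2)) in *; clearbody c s r.
    apply (Rmult_eq_reg_r r); [|lra].
    transitivity (c * (r * r) - s * s * c); [field; lra|].
    transitivity (2 * c ^ 3); [|field; lra].
    rewrite Es; replace (c ^ 3) with (c * (1 - s * s)) by (rewrite <- E; ring); ring.
  + apply continuous_comp; [apply continuous_cos|].
    apply continuous_F; pose proof (COS_bound th); lra.
- cbv [minus plus opp]; simpl.
  replace (- PI / 2) with (- (PI / 2)) by field.
  rewrite sin_neg, sin_PI2.
  replace (2 - 1 * (1 * 1)) with 1 by ring.
  replace (2 - - (1) * (- (1) * 1)) with 1 by ring.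
  rewrite sqrt_1; ring.
Qed.

(** This is the slope of [K] at 1. The same substitution gives [(1 - 2 s^2) (5 - 2 s^2) / (2 -
    s^2)^(3/2) ds], with primitive [s (5/2 - 2 s^2) / sqrt (2 - s^2)]. *)
Lemma is_RInt_dF_cos : is_RInt (fun th => cos th * dF (cos th)) (- PI) PI 1.
Proof.
pose proof PI_RGT_0.
evar_last.
- apply (is_RInt_derive
    (fun th => sin (th / 2) * (5 / 2 - 2 * sin (th / 2) ^ 2) / sqrt (2 - sin (th / 2) ^ 2))
    (fun th => cos th * dF (cos th)));
    rewrite Rmin_left, Rmax_right by lra; intros th Hth.
  + unfold dF; rewrite ratio_sqrt_cos by assumption.
    pose proof (sin2_cos2 (th / 2)) as E; unfold Rsqr in E.
    assert (H2 : 0 < 2 - sin (th / 2) ^ 2) by nra.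
    pose proof (sqrt_lt_R0 _ H2); pose proof (sqrt_sqrt _ (Rlt_le _ _ H2)) as Es.
    auto_derive;
      replace (2 + - (sin (th * / 2) * (sin (th * / 2) * 1)))
        with (2 - sin (th / 2) ^ 2) by (unfold Rdiv; ring);
      [repeat apply conj; auto; lra|].
    rewrite (cos_half th).
    fold (th / 2).
    set (c := cos (th / 2)) in *; set (s := sin (th / 2)) in *.
    set (r := sqrt (2 - s ^ 2)) in *; clearbody c s r.
    assert (Ec : c ^ 2 = 1 - s * s) by (rewrite <- E; ring).
    rewrite Ec.
    apply (Rmult_eq_reg_r (r * r * r)); [|repeat apply Rmult_integral_contrapositive_currified; lra].
    transitivity (c * (5 / 4 - 3 * (s * s)) * (r * r) + s * s * (5 / 2 - 2 * (s * s)) * c / 2);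
      [field; lra|].
    transitivity ((1 - 2 * (s * s)) * (5 - 2 * (s * s)) / (2 * (2 - s * s)) * c * (r * r));
      [rewrite Es; field; nra | field; split; nra].
  + apply (continuous_mult cos); [apply continuous_cos|].
    apply continuous_comp; [apply continuous_cos|].
    apply continuous_dF; pose proof (COS_bound th); lra.
- cbv [minus plus opp]; simpl.
  replace (- PI / 2) with (- (PI / 2)) by field.
  rewrite sin_neg, sin_PI2.
  replace (2 - 1 * (1 * 1)) with 1 by ring.
  replace (2 - - (1) * (- (1) * 1)) with 1 by ring.
  rewrite sqrt_1; field.
Qed.

Lemma is_RInt_cos_period : is_RInt cos (- PI) PI 0.
Proof.
evar_last.
- apply (is_RInt_derive sin cos); intros th _; [apply is_derive_sin | apply continuous_cos].
- cbv [minus plus opp]; simpl; rewrite sin_neg, sin_PI; ring.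
Qed.

Lemma K_1 : K 1 = 4.
Proof.
apply is_RInt_unique; apply (is_RInt_ext (fun th => F (cos th))); [|exact is_RInt_F_cos].
intros th _; f_equal; ring.
Qed.

(** The two bounds of [F_increment] are integrated over a period. Working with increments replaces
    differentiation under the integral sign. *)
Lemma K_increment (p q : R) : 0 <= p -> p < q -> q <= 1 -> 0 <= K q - K p <= q - p.
Proof.
intros Hp Hpq Hq; pose proof PI_RGT_0.
assert (HK : is_RInt (fun th => F (q * cos th) - F (p * cos th)) (- PI) PI (K q - K p)).
{ apply (is_RInt_minus (V := R_NormedModule) (fun th => F (q * cos th)));
    apply (RInt_correct (V := R_CompleteNormedModule)), ex_RInt_F_cos; lra. }
assert (Hl : is_RInt (fun th => (q - p) * dF 0 * cos th) (- PI) PI ((q - p) * dF 0 * 0)).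
{ apply (is_RInt_scal (V := R_NormedModule) cos), is_RInt_cos_period. }
assert (Hr : is_RInt (fun th => (q - p) * (cos th * dF (cos th))) (- PI) PI ((q - p) * 1)).
{ apply (is_RInt_scal (V := R_NormedModule) (fun th => cos th * dF (cos th))), is_RInt_dF_cos. }
split.
- rewrite <- (Rmult_0_r ((q - p) * dF 0)).
  apply (is_RInt_le _ _ (- PI) PI _ _ ltac:(lra) Hl HK); intros th _.
  pose proof (F_increment p q (cos th) Hp Hpq Hq (COS_bound th)); lra.
- rewrite <- (Rmult_1_r (q - p)).
  apply (is_RInt_le _ _ (- PI) PI _ _ ltac:(lra) HK Hr); intros th _.
  apply (F_increment p q (cos th) Hp Hpq Hq (COS_bound th)).
Qed.

Lemma K_lower (q : R) : 0 <= q < 1 -> 3 + q <= K q.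
Proof.
intros Hq; pose proof (K_increment q 1 ltac:(lra) ltac:(lra) ltac:(lra)); rewrite K_1 in *; lra.
Qed.

(** * Monotonicity of the two endpoint coordinates in q *)

Lemma first_coordinate_increasing (p q : R) :
  0 <= p -> p < q -> q < 1 -> K p / (1 - p) < K q / (1 - q).
Proof.
intros Hp Hpq Hq.
pose proof (K_increment p q Hp Hpq ltac:(lra)); pose proof (K_lower p ltac:(lra)).
assert (/ (1 - p) < / (1 - q)) by (apply Rinv_lt_contravar; nra).
assert (0 < / (1 - p)) by (apply Rinv_0_lt_compat; lra).
unfold Rdiv; nra.
Qed.

Lemma second_coordinate_decreasing (p q : R) :
  0 <= p -> p < q -> q < 1 -> K q / sqrt (1 + q) <= K p / sqrt (1 + p).
Proof.
intros Hp Hpq Hq.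
pose proof (K_increment p q Hp Hpq ltac:(lra)); pose proof (K_lower q ltac:(lra)).
pose proof (K_lower p ltac:(lra)).
assert (Ha : 0 < sqrt (1 + p)) by (apply sqrt_lt_R0; lra).
assert (Hab : sqrt (1 + p) < sqrt (1 + q)) by (apply sqrt_lt_1_alt; lra).
pose proof (sqrt_sqrt (1 + p) ltac:(lra)) as Ea; pose proof (sqrt_sqrt (1 + q) ltac:(lra)) as Eb.
set (a := sqrt (1 + p)) in *; set (b := sqrt (1 + q)) in *; clearbody a b.
apply Rle_div_l; [lra|].
replace (K p / a * b) with (K p * b / a) by (field; lra).
apply Rle_div_r; [lra|].
(* With [1 + p = a^2], [1 + q = b^2]: [K q (b - a) >= 2 b^2 (b - a) >= (b^2 - a^2) b]. *)
assert (2 * (b * b) * (b - a) <= K q * (b - a)) by (apply Rmult_le_compat_r; lra).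
assert (b * (K q - K p) <= b * ((b - a) * (b + a))) by (apply Rmult_le_compat_l; lra).
assert (b * ((b - a) * (b + a)) <= 2 * (b * b) * (b - a)).
{ pose proof (Rmult_le_pos b ((b - a) ^ 2) ltac:(lra) (pow2_ge_0 _)); lra. }
lra.
Qed.

(** * The level curves of Sigma *)

(* The closed curve of [Sigma] whose [x] coordinate oscillates between
   [m (1 + q)] and [m (1 - q)]; it has [x y^2] constant, and [th] runs along it
   at rate [speed]. It lies on the unit sphere only when [m^2 (3 + q^2) = 1], a
   relation which is not imposed. *)
Definition abscissa (m q th : R) : R := m * (1 + q * cos th).

Definition speed (m q th : R) : R := sqrt (abscissa m q th * (abscissa m q th + 2 * m)).

(** The value [2 m^3 (1 - q^2)] of [x y^2] is the one for which the points with [z = 0] at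
    [x = m (1 + q)] and [x = m (1 - q)] lie on the same sphere. The third component is [x' / x], as
    [x' = x z] demands. *)
Definition level_curve (m q th : R) : R3 :=
  (abscissa m q th, sqrt (2 * m ^ 3 * (1 - q ^ 2) / abscissa m q th),
   - (m * q * sin th) * speed m q th / abscissa m q th).

Definition time (m q th : R) : R := RInt (fun s => / speed m q s) 0 th.

Lemma abscissa_ge (m q th : R) : 0 < m -> 0 < q < 1 -> m * (1 - q) <= abscissa m q th.
Proof.
intros Hm Hq; unfold abscissa; pose proof (COS_bound th); apply Rmult_le_compat_l; nra.
Qed.

Lemma abscissa_pos (m q th : R) : 0 < m -> 0 < q < 1 -> 0 < abscissa m q th.
Proof.
intros Hm Hq; pose proof (abscissa_ge m q th Hm Hq); nra.
Qed.

Lemma speed_sqr (m q th : R) : 0 < m -> 0 < q < 1 ->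
  speed m q th * speed m q th = abscissa m q th * (abscissa m q th + 2 * m).
Proof.
intros Hm Hq; apply sqrt_sqrt; pose proof (abscissa_pos m q th Hm Hq); nra.
Qed.

(** This uniform bound keeps the time-change factor [/ speed] bounded, as [Sigma_unique]
    requires. *)
Lemma speed_ge (m q th : R) : 0 < m -> 0 < q < 1 -> m * (1 - q) <= speed m q th.
Proof.
intros Hm Hq; pose proof (abscissa_ge m q th Hm Hq).
apply Rle_trans with (abscissa m q th); [assumption|].
rewrite <- (sqrt_square (abscissa m q th)) at 1 by nra.
apply sqrt_le_1_alt; nra.
Qed.

Lemma speed_pos (m q th : R) : 0 < m -> 0 < q < 1 -> 0 < speed m q th.
Proof.
intros Hm Hq; pose proof (speed_ge m q th Hm Hq); nra.
Qed.

Lemma is_derive_abscissa (m q th : R) :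
  is_derive (abscissa m q) th (- (m * q * sin th)).
Proof.
unfold abscissa; auto_derive; auto; ring.
Qed.

Lemma is_derive_speed (m q th : R) : 0 < m -> 0 < q < 1 ->
  is_derive (speed m q) th (- (m * q * sin th) * (abscissa m q th + m) / speed m q th).
Proof.
intros Hm Hq; pose proof (is_derive_abscissa m q th).
pose proof (abscissa_pos m q th Hm Hq); pose proof (speed_pos m q th Hm Hq).
apply (is_derive_ext (fun th => sqrt (abscissa m q th * (abscissa m q th + 2 * m))));
  [intros; reflexivity|].
auto_derive.
- repeat apply conj; try exact I; try (eexists; eassumption); nra.
- rewrite_Derive; fold (speed m q th); field; lra.
Qed.

Lemma level_curve_derive (m q th : R) : 0 < m -> 0 < q < 1 ->
  is_derive3 (level_curve m q) th (scale (/ speed m q th) (Sigma (level_curve m q th))).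
Proof.
intros Hm Hq; pose proof (is_derive_abscissa m q th) as Hx.
pose proof (is_derive_speed m q th Hm Hq) as HR.
pose proof (abscissa_pos m q th Hm Hq) as X0; pose proof (speed_pos m q th Hm Hq) as R0.
pose proof (speed_sqr m q th Hm Hq) as ER.
pose proof (sin2_cos2 th) as Esc; unfold Rsqr in Esc.
assert (Ec : m * q * cos th = abscissa m q th - m) by (unfold abscissa; ring).
assert (C0 : 0 < 2 * m ^ 3 * (1 - q ^ 2) / abscissa m q th).
{ apply Rdiv_lt_0_compat; [|assumption].
  apply Rmult_lt_0_compat; [pose proof (pow_lt m 3 Hm); lra | nra]. }
pose proof (sqrt_lt_R0 _ C0) as Y0; pose proof (sqrt_sqrt _ (Rlt_le _ _ C0)) as EY.
intros [].
- apply (is_derive_ext (abscissa m q)); [intros; reflexivity|].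
  evar_last; [exact Hx|]; simpl.
  field; lra.
- apply (is_derive_ext (fun s => sqrt (2 * m ^ 3 * (1 - q ^ 2) / abscissa m q s)));
    [intros; reflexivity|]; cbn [coord scale Sigma level_curve].
  set (k := 2 * m ^ 3 * (1 - q ^ 2)) in *; clearbody k.
  auto_derive.
  + repeat apply conj; try exact I; try (eexists; eassumption); try lra; exact C0.
  + rewrite_Derive; fold (k / abscissa m q th).
    set (y := sqrt (k / abscissa m q th)) in *.
    apply (Rmult_eq_reg_r y); [|lra].
    transitivity (/ 2 * (m * q * sin th) / abscissa m q th * (y * y));
      [rewrite EY; field; lra | field; lra].
- apply (is_derive_ext (fun s => - (m * q * sin s) * speed m q s / abscissa m q s));
    [intros; reflexivity|]; cbn [coord scale Sigma level_curve].
  auto_derive.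
  + repeat apply conj; try exact I; try (eexists; eassumption); lra.
  + rewrite_Derive; rewrite pow2_sqrt by lra.
    set (x := abscissa m q th) in *; set (r := speed m q th) in *.
    (* With [m q cos th = x - m] and [r^2 = x (x + 2 m)], all trigonometric terms and roots are
       eliminated, leaving a rational identity in [x], [m], [q]. *)
    assert (Es : (m * q * sin th) ^ 2 = (m * q) ^ 2 - (x - m) ^ 2).
    { rewrite <- Ec; transitivity ((m * q) ^ 2 * (sin th * sin th + cos th * cos th)
        - (m * q * cos th) ^ 2); [ring | rewrite Esc; ring]. }
    apply (Rmult_eq_reg_r r); [|lra].
    transitivity (- (m * q * cos th) * (r * r) / x
      + (m * q * sin th) ^ 2 * ((x + m) / x - r * r / x ^ 2)); [field; lra|].
    rewrite Ec, Es, ER; field; lra.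
Qed.

(** * Time along the level curve and the minimal period *)

Lemma is_derive_time (m q th : R) : 0 < m -> 0 < q < 1 ->
  is_derive (time m q) th (/ speed m q th).
Proof.
intros Hm Hq.
assert (C : forall s, continuous (fun s => / speed m q s) s).
{ intros s; pose proof (is_derive_speed m q s Hm Hq); pose proof (speed_pos m q s Hm Hq).
  apply (ex_derive_continuous (fun s => / speed m q s)); auto_derive.
  repeat apply conj; try exact I; try (eexists; eassumption); lra. }
apply (is_derive_RInt (fun s => / speed m q s) (time m q) 0 th); [|apply C].
apply filter_forall; intros s; apply (RInt_correct (V := R_CompleteNormedModule)).
apply (ex_RInt_continuous (V := R_CompleteNormedModule)); auto.
Qed.

Lemma time_0 (m q : R) : time m q 0 = 0.
Proof.
exact (RInt_point (V := R_CompleteNormedModule) 0 _).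
Qed.

Lemma time_opp (m q th : R) : 0 < m -> 0 < q < 1 -> time m q (- th) = - time m q th.
Proof.
intros Hm Hq.
assert (E : time m q th + time m q (- th) = time m q 0 + time m q (- 0)).
{ apply (derive_zero_const (fun s => time m q s + time m q (- s))); intros s.
  pose proof (is_derive_time m q s Hm Hq) as H1.
  pose proof (is_derive_time m q (- s) Hm Hq) as H2.
  replace (speed m q (- s)) with (speed m q s) in H2
    by (unfold speed, abscissa; rewrite cos_neg; reflexivity).
  derive_using_hyps; ring. }
rewrite Ropp_0, time_0 in E; lra.
Qed.

Lemma time_pos (m q : R) : 0 < m -> 0 < q < 1 -> 0 < time m q PI.
Proof.
intros Hm Hq; pose proof PI_RGT_0.
destruct (MVT_gen (time m q) 0 PI (fun th => / speed m q th)) as (c & _ & E).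
- intros s _; apply is_derive_time; assumption.
- intros s _; exact (is_derive_continuity_pt _ _ _ (is_derive_time m q s Hm Hq)).
- rewrite time_0 in E.
  pose proof (Rinv_0_lt_compat _ (speed_pos m q c Hm Hq)); nra.
Qed.

(** [Sigma] is homogeneous of degree 2, so scaling a solution by [k] amounts to running it [k] times
    faster. *)
Lemma integral_curve_rescale (c : R -> R3) (k l : R) :
  is_integral_curve Sigma c -> is_integral_curve Sigma (fun t => scale k (c (k * t + l))).
Proof.
intros Hc t i.
assert (H : is_derive3 (fun s => c (k * s + l)) t (scale k (Sigma (c (k * t + l))))).
{ apply (is_derive3_comp c (fun s => k * s + l)); [apply Hc|].
  auto_derive; auto; ring. }
apply (is_derive_ext (fun s => k * coord (c (k * s + l)) i)).
- intros s; destruct (c (k * s + l)) as [[x y] z], i; reflexivity.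
- evar_last; [apply (is_derive_scal _ _ k), H|].
  destruct (c (k * t + l)) as [[x y] z], i; simpl; cbv [scal mult]; simpl; ring.
Qed.

(** The comparison is made in the variable [th], where both curves follow [Sigma] with the factor
    [/ speed m q th]. *)
Lemma level_curve_time (c : R -> R3) (m q : R) : 0 < m -> 0 < q < 1 ->
  is_integral_curve Sigma c -> c 0 = level_curve m q 0 ->
  forall th, c (time m q th) = level_curve m q th.
Proof.
intros Hm Hq Hc H0.
apply (Sigma_unique (fun th => c (time m q th)) (level_curve m q)
  (fun th => / speed m q th) (/ (m * (1 - q)))).
- intros th; pose proof (speed_pos m q th Hm Hq); pose proof (speed_ge m q th Hm Hq).
  rewrite Rabs_pos_eq; [|left; apply Rinv_0_lt_compat; assumption].
  apply Rinv_le_contravar; nra.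
- intros th; apply is_derive3_comp; [apply Hc | apply is_derive_time; assumption].
- intros th; apply level_curve_derive; assumption.
- rewrite time_0; assumption.
Qed.

Lemma level_curve_minimal_period (c : R -> R3) (m q P : R) : 0 < m -> 0 < q < 1 ->
  is_integral_curve Sigma c -> c 0 = level_curve m q 0 ->
  is_minimal_period c P -> P = 2 * time m q PI.
Proof.
intros Hm Hq Hc H0 ((P0 & HP) & Hmin).
pose proof (level_curve_time c m q Hm Hq Hc H0) as HT.
pose proof (time_pos m q Hm Hq) as T0; pose proof PI_RGT_0.
pose proof (time_opp m q PI Hm Hq) as To.
assert (Hper : is_period c (2 * time m q PI)).
{ split; [lra|]; intros t.
  (* The shifts of [c] by plus and minus [time m q PI] are compared: they agree at 0 because
     [level_curve] takes the same value at [PI] and [- PI]. *)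
  replace (t + 2 * time m q PI) with ((t + time m q PI) + time m q PI) by ring.
  replace t with ((t + time m q PI) + - time m q PI) at 2 by ring.
  assert (Hs : forall l, is_integral_curve Sigma (fun s => c (s + l))).
  { intros l s; rewrite <- (scale_1 (Sigma _)).
    apply (is_derive3_comp c (fun s => s + l)); [apply Hc | auto_derive; auto]. }
  apply (integral_curve_unique (fun s => c (s + time m q PI)) (fun s => c (s + - time m q PI)));
    [apply Hs | apply Hs |].
  rewrite !Rplus_0_l, <- To, !HT.
  unfold level_curve, speed, abscissa; rewrite cos_neg, sin_neg, sin_PI.
  f_equal; unfold Rdiv; ring. }
apply Rle_antisym; [apply Hmin, Hper|].
apply Rnot_lt_le; intros Hlt.
(* A shorter period would bring [c] back to its lowest [x] at a time strictly between those of
   [- PI] and [PI]; but on this interval [cos th = -1] only at the two ends. *)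
destruct (IVT_gen (time m q) (- PI) PI (- time m q PI + P)) as (th & Hth & E).
- intros s; exact (is_derive_continuity_pt _ _ _ (is_derive_time m q s Hm Hq)).
- rewrite To, Rmin_left, Rmax_right; lra.
- rewrite Rmin_left, Rmax_right in Hth by lra.
  assert (E' : level_curve m q th = level_curve m q (- PI))
    by (rewrite <- !HT, E, HP, To; reflexivity).
  apply (f_equal (fun p => coord p ax_x)) in E'; simpl in E'.
  unfold abscissa in E'; rewrite cos_neg, cos_PI in E'.
  assert (Ec : cos th = - 1).
  { apply Rmult_eq_reg_l in E'; [|lra].
    apply (Rmult_eq_reg_l q); lra. }
  destruct (Rle_dec 0 th) as [Hs | Hs].
  + assert (th = PI); [|subst th; lra].
    apply cos_inj; try lra; rewrite cos_PI; exact Ec.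
  + assert (- th = PI); [|replace th with (- PI) in E by lra; lra].
    apply cos_inj; try lra; rewrite cos_neg, cos_PI; exact Ec.
Qed.

(** * The boundary point in terms of q *)

Lemma start_on_level_curve (x0 : R) : 1 / sqrt 3 < x0 < 1 ->
  exists m q, 0 < m /\ 0 < q < 1 /\ start x0 = level_curve m q 0.
Proof.
intros [Hl Hu].
assert (H3 : 0 < sqrt 3) by (apply sqrt_lt_R0; lra).
pose proof (sqrt_sqrt 3 ltac:(lra)) as E3.
assert (Hx0 : 0 < x0) by (apply Rlt_trans with (1 / sqrt 3); [apply Rdiv_lt_0_compat|]; lra).
assert (Hx : 1 < 3 * x0 ^ 2).
{ apply Rlt_div_l in Hl; [|assumption].
  replace (3 * x0 ^ 2) with ((x0 * sqrt 3) * (x0 * sqrt 3)); [nra|].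
  transitivity (x0 ^ 2 * (sqrt 3 * sqrt 3)); [ring | rewrite E3; ring]. }
(* Eliminating [q] from [x0 = m (1 + q)] and [m^2 (3 + q^2) = 1] gives
   [4 m^2 - 2 x0 m + x0^2 - 1 = 0], whose larger root is [m]. Then [q > 0] means [d < 3 x0], and
   [q < 1] means [x0 < d]. *)
set (d := sqrt (4 - 3 * x0 ^ 2)).
assert (Ed : d * d = 4 - 3 * x0 ^ 2) by (apply sqrt_sqrt; nra).
assert (Hd : 0 <= d) by apply sqrt_pos.
set (m := (x0 + d) / 4).
assert (Hm : 0 < m) by (unfold m; lra).
assert (d < 3 * x0) by nra.
assert (x0 < d) by nra.
exists m, (x0 / m - 1).
assert (Hq : 0 < x0 / m - 1 < 1).
{ split.
  - apply Rlt_0_minus, Rlt_div_r; unfold m; lra.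
  - apply Rlt_minus_l, Rlt_div_l; unfold m; lra. }
split; [assumption|split; [assumption|]].
unfold start, level_curve, abscissa; rewrite cos_0, sin_0.
replace (m * (1 + (x0 / m - 1) * 1)) with x0 by (field; lra).
f_equal; [f_equal|].
- f_equal; apply (Rmult_eq_reg_r x0); [|lra].
  transitivity (2 * m * (2 * m * x0 - x0 ^ 2)); [|field; lra].
  transitivity ((x0 + d) / 2 * ((x0 + d) / 2 * x0 - x0 ^ 2)); [|unfold m; field].
  transitivity (x0 * (d * d - x0 ^ 2) / 4); [rewrite Ed; field | field].
- field; lra.
Qed.

Lemma endpoint (c : R -> R3) (m q : R) : 0 < m -> 0 < q < 1 ->
  is_integral_curve Sigma c -> c 0 = level_curve m q 0 ->
  riem_exp (scale (2 * time m q PI) (level_curve m q (- PI))) =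
  (K q / (1 - q), sqrt 2 * (K q / sqrt (1 + q)), 0).
Proof.
intros Hm Hq Hc H0.
pose proof (level_curve_time c m q Hm Hq Hc H0) as HT.
pose proof (time_pos m q Hm Hq) as T0; pose proof PI_RGT_0.
pose proof (time_opp m q PI Hm Hq) as To.
set (tau := time m q PI) in *.
(* The momentum rescaled to unit time: it runs once around the level curve, from [th = - PI] at
   [t = 0] to [th = PI] at [t = 1]. *)
set (w := fun t => scale (2 * tau) (c (2 * tau * t + - tau))).
assert (Hw : is_integral_curve Sigma w) by (apply integral_curve_rescale; assumption).
assert (S0 : 0 < sqrt (1 + q)) by (apply sqrt_lt_R0; lra).
assert (S2 : 0 < sqrt 2) by (apply sqrt_lt_R0; lra).
set (y1 := m * sqrt 2 * sqrt (1 + q)).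
assert (Y1 : 0 < y1) by (unfold y1; repeat apply Rmult_lt_0_compat; assumption).
assert (Eend : forall s, cos s = - 1 -> sin s = 0 ->
  level_curve m q s = (m * (1 - q), y1, 0)).
{ intros s E1 E2; unfold level_curve, abscissa; rewrite E1, E2.
  replace (1 + q * - 1) with (1 - q) by ring.
  f_equal; [f_equal|field; nra].
  replace (2 * m ^ 3 * (1 - q ^ 2) / (m * (1 - q))) with (2 * m ^ 2 * (1 + q))
    by (field; lra).
  apply sqrt_lem_1; [nra | lra |].
  transitivity (m ^ 2 * (sqrt 2 * sqrt 2) * (sqrt (1 + q) * sqrt (1 + q)));
    [unfold y1; ring | rewrite !sqrt_sqrt by lra; ring]. }
assert (W0 : w 0 = scale (2 * tau) (level_curve m q (- PI)))
  by (unfold w; rewrite <- HT, To; do 2 f_equal; ring).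
assert (W1 : w 1 = scale (2 * tau) (level_curve m q PI))
  by (unfold w; rewrite <- HT; do 2 f_equal; fold tau; ring).
rewrite <- W0.
rewrite Eend in W0, W1; try (rewrite ?cos_neg, ?sin_neg, ?cos_PI, ?sin_PI; ring).
simpl in W0, W1; rewrite Rmult_0_r in W0, W1.
destruct (riem_exp_momentum w Hw) as (g & g0 & Hg & ->).
destruct (geodesic_loop w g (2 * tau * (m * (1 - q))) (2 * tau * y1)) as (Dx & Eb & Ez);
  auto; [repeat apply Rmult_lt_0_compat; lra | apply Rmult_lt_0_compat; lra |].
assert (Ea : component g ax_x 1 = K q / (1 - q)).
(* The formula [Dx] for the derivative of the first coordinate is integrated after the change of
   variable [t = (time m q th + tau) / (2 tau)]. *)
{ assert (HI : is_RInt (fun th => / (1 - q) * F (q * cos th)) (- PI) PI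
    (component g ax_x 1 - component g ax_x 0)).
  { evar_last.
    - apply (is_RInt_derive (fun th => component g ax_x ((time m q th + tau) / (2 * tau)))
        (fun th => / (1 - q) * F (q * cos th))); intros th _.
      + assert (D : is_derive (component g ax_x) ((time m q th + tau) / (2 * tau))
          ((2 * tau * abscissa m q th) ^ 2 / (2 * tau * (m * (1 - q))))).
        { replace (2 * tau * abscissa m q th)
            with (component w ax_x ((time m q th + tau) / (2 * tau))); [apply Dx|].
          unfold component, w.
          replace (2 * tau * ((time m q th + tau) / (2 * tau)) + - tau) with (time m q th)
            by (field; lra).
          rewrite HT; reflexivity. }
        pose proof (is_derive_time m q th Hm Hq) as Dt.
        unfold Rdiv at 1 in D; derive_using_hyps.
        pose proof (speed_pos m q th Hm Hq); pose proof (abscissa_pos m q th Hm Hq).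
        pose proof (COS_bound th).
        assert (1 + q * cos th > 0) by nra.
        unfold F; set (u := q * cos th) in *.
        assert (Esp : speed m q th = m * (3 + u) * sqrt ((1 + u) / (3 + u))).
        { unfold speed, abscissa; fold u.
          rewrite <- (sqrt_pow2 (m * (3 + u))) by nra.
          rewrite <- sqrt_mult; [f_equal; field; nra | nra | apply Rdiv_le_0_compat; nra]. }
        assert (Es : sqrt ((1 + u) / (3 + u)) * sqrt ((1 + u) / (3 + u)) = (1 + u) / (3 + u))
          by (apply sqrt_sqrt, Rdiv_le_0_compat; lra).
        assert (0 < sqrt ((1 + u) / (3 + u))) by (apply sqrt_lt_R0, Rdiv_lt_0_compat; lra).
        rewrite Esp; unfold abscissa; fold u.
        set (r := sqrt ((1 + u) / (3 + u))) in *; clearbody r u.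
        apply (Rmult_eq_reg_r r); [|lra].
        transitivity (/ (1 - q) * (1 + u) * ((1 + u) / (3 + u))); [|rewrite <- Es; ring].
        field; repeat split; lra.
      + apply (continuous_scal_r (/ (1 - q)) (fun th => F (q * cos th))).
        pose proof (COS_bound th).
        apply (continuous_comp (fun th => q * cos th) F); [|apply continuous_F; nra].
        apply (ex_derive_continuous (fun th => q * cos th)); auto_derive; auto.
    - cbv [minus plus opp]; simpl; rewrite To; fold tau.
      replace ((tau + tau) / (2 * tau)) with 1 by (field; lra).
      replace ((- tau + tau) / (2 * tau)) with 0 by (field; lra); reflexivity. }
  assert (HK : is_RInt (fun th => / (1 - q) * F (q * cos th)) (- PI) PI (/ (1 - q) * K q)).
  { apply (is_RInt_scal (V := R_NormedModule) (fun th => F (q * cos th))).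
    apply (RInt_correct (V := R_CompleteNormedModule)), ex_RInt_F_cos; lra. }
  apply (is_RInt_unique (V := R_CompleteNormedModule)) in HI.
  apply (is_RInt_unique (V := R_CompleteNormedModule)) in HK.
  rewrite HI in HK; unfold component in HK at 2; rewrite g0 in HK; simpl in HK.
  unfold Rdiv; lra. }
apply R3_ext; intros []; simpl; [exact Ea | | exact Ez].
change (coord (g 1) ax_y) with (component g ax_y 1).
apply (Rmult_eq_reg_l (2 * tau * y1)); [|nra].
rewrite Eb, Ea; unfold y1.
pose proof (sqrt_sqrt 2 ltac:(lra)) as E2.
transitivity (2 * tau * m * K q * (sqrt 2 * sqrt 2)); [rewrite E2|]; field; lra.
Qed.

(** The field driving [u] is [- Sigma], so [u t = c (- t)]; at half the period this is the point of
    the level curve at [th = - PI]. *)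
Lemma boundary_point (x0 P : R) (c u : R -> R3) : 1 / sqrt 3 < x0 < 1 ->
  c 0 = start x0 -> is_integral_curve Sigma c -> is_minimal_period c P ->
  u 0 = start x0 ->
  is_integral_curve
    (fun v => let '(x, y, z) := v in
       (- (x * z), / 2 * (y * z), x ^ 2 - / 2 * y ^ 2)) u ->
  exists q, 0 < q < 1 /\
    riem_exp (scale (2 * (P / 2)) (u (P / 2))) =
    (K q / (1 - q), sqrt 2 * (K q / sqrt (1 + q)), 0).
Proof.
intros Hx0 Hc0 Hc HP Hu0 Hu.
destruct (start_on_level_curve x0 Hx0) as (m & q & Hm & Hq & E0).
rewrite E0 in Hc0, Hu0.
exists q; split; [assumption|].
rewrite <- (endpoint c m q Hm Hq Hc Hc0).
pose proof (level_curve_minimal_period c m q P Hm Hq Hc Hc0 HP) as ->.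
replace (2 * time m q PI / 2) with (time m q PI) by field.
f_equal; f_equal.
rewrite <- (level_curve_time c m q Hm Hq Hc Hc0), time_opp by assumption.
apply (Sigma_unique u (fun t => c (- t)) (fun _ => -1) 1).
- intros _; rewrite Rabs_left; lra.
- intros t; pose proof (Hu t) as H.
  replace (scale (-1) (Sigma (u t)))
    with (let '(x, y, z) := u t in (- (x * z), / 2 * (y * z), x ^ 2 - / 2 * y ^ 2));
    [exact H|].
  destruct (u t) as [[x y] z]; simpl; f_equal; [f_equal|]; ring.
- intros t; apply (is_derive3_comp c Ropp); [apply Hc | auto_derive; auto; ring].
- rewrite Ropp_0, Hc0; exact Hu0.
Qed.

Theorem theorem5p13 (P : R -> R) (sigma u : R -> R -> R3)
  (Hsigma : forall x0, 1 / sqrt 3 < x0 < 1 ->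
     sigma x0 0 = start x0 /\ is_integral_curve Sigma (sigma x0))
  (HP : forall x0, 1 / sqrt 3 < x0 < 1 ->
     is_minimal_period (sigma x0) (P x0))
  (Hu : forall x0, 1 / sqrt 3 < x0 < 1 ->
     u x0 0 = start x0 /\
     is_integral_curve
       (fun v => let '(x, y, z) := v in
          (- (x * z), / 2 * (y * z), x ^ 2 - / 2 * y ^ 2)) (u x0)) :
  is_nonincreasing_graph (boundary0_Nplus P u).
Proof.
assert (HS : forall a b z, boundary0_Nplus P u (a, b, z) -> exists q, 0 < q < 1 /\
  a = K q / (1 - q) /\ b = sqrt 2 * (K q / sqrt (1 + q)) /\ z = 0).
{ intros a b z (x0 & Hx0 & E).
  destruct (Hsigma x0 Hx0) as (Hc0 & Hc), (Hu x0 Hx0) as (Hu0 & Hui).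
  destruct (boundary_point x0 (P x0) (sigma x0) (u x0) Hx0 Hc0 Hc (HP x0 Hx0) Hu0 Hui)
    as (q & Hq & Eq).
  exists q; split; [assumption|]; rewrite Eq in E; injection E; auto. }
assert (Hmono : forall a b z a' b' z', boundary0_Nplus P u (a, b, z) ->
  boundary0_Nplus P u (a', b', z') -> a <= a' -> b' <= b).
{ intros a b z a' b' z' H H' Haa'.
  destruct (HS a b z H) as (q & Hq & -> & -> & _).
  destruct (HS a' b' z' H') as (q' & Hq' & -> & -> & _).
  apply Rmult_le_compat_l; [apply sqrt_pos|].
  (* The case [q' < q] contradicts [a <= a'], because the first coordinate is strictly
     increasing. *)
  destruct (Rtotal_order q q') as [Hlt | [-> | Hlt]]; [| apply Rle_refl |].
  - apply second_coordinate_decreasing; lra.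
  - pose proof (first_coordinate_increasing q' q ltac:(lra) Hlt ltac:(lra)); lra. }
set (D := fun a => exists b, boundary0_Nplus P u (a, b, 0)).
set (f := fun a => epsilon (inhabits 0) (fun b => boundary0_Nplus P u (a, b, 0))).
assert (Hf : forall a, D a -> boundary0_Nplus P u (a, f a, 0))
  by (intros a Ha; apply epsilon_spec, Ha).
exists D, f; split.
- intros a a' Ha Ha'; exact (Hmono _ _ _ _ _ _ (Hf a Ha) (Hf a' Ha')).
- intros a b z; split.
  + intros H; destruct (HS a b z H) as (_ & _ & _ & _ & ->).
    assert (Ha : D a) by (exists b; assumption).
    repeat split; [assumption|].
    (* [Hmono] applied both ways to two points with the same abscissa shows that the curve is
       single-valued. *)
    apply Rle_antisym;
      [apply (Hmono _ _ _ _ _ _ (Hf a Ha) H) | apply (Hmono _ _ _ _ _ _ H (Hf a Ha))];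
      apply Rle_refl.
  + intros (Ha & -> & ->); apply Hf, Ha.
Qed.
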